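(* Let $\mathcal{Q}$ be a quasivariety of algebras with a majority term and let $\mathcal{S}=\mathbb{P}_u(\mathcal{Q}_{RSI})$. The following are equivalent: (1) $\mathcal{Q}$ has surjective epimorphisms. (2) For all $\mathbf{A},\mathbf{B}\in\mathcal{Q}$, if $\mathbf{A}\leq_e\mathbf{B}$ in $\mathcal{Q}$, then $\mathbf{A}=\mathbf{B}$. (3) For all $\mathbf{A},\mathbf{B}\in\mathbb{S}(\mathcal{S}\times\mathcal{S})$, if $\mathbf{A}\leq_e\mathbf{B}$ in $\mathcal{S}\times\mathcal{S}$, then $\mathbf{A}=\mathbf{B}$. (4) $\mathbb{S}(\mathcal{S}\times\mathcal{S})$ has surjective epimorphisms.
   Context: All languages are algebraic (no relation symbols); algebras are nonempty. $\mathbb{S}$ and $\mathbb{P}_u$ denote the class operators of taking subalgebras and ultraproducts. $\mathcal{S}\times\mathcal{S}:=\{\mathbf{C}\times\mathbf{D}\mid\mathbf{C},\mathbf{D}\in\mathcal{S}\}$. A majority term for a class is a term $t(x_1,x_2,x_3)$ such that the class satisfies $t(x,x,y)=t(x,y,x)=t(y,x,x)=x$. An algebra $\mathbf{A}\in\mathcal{Q}$ is relatively subdirectly irreducible if its diagonal congruence is completely meet irreducible in the lattice of $\mathcal{Q}$-congruences of $\mathbf{A}$ (congruences $\theta$ with $\mathbf{A}/\theta\in\mathcal{Q}$); $\mathcal{Q}_{RSI}$ is the class of relatively subdirectly irreducible members of $\mathcal{Q}$. For a class $\mathcal{K}$, $\mathbf{A}\leq_e\mathbf{B}$ in $\mathcal{K}$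 ($\mathbf{A}$ is an epic subalgebra of $\mathbf{B}$ in $\mathcal{K}$) means that $\mathbf{A}$ is a subalgebra of $\mathbf{B}$ and for every $\mathbf{C}\in\mathcal{K}$ and all homomorphisms $g,g':\mathbf{B}\to\mathbf{C}$ with $g|_A=g'|_A$ we have $g=g'$. For $\mathbf{A},\mathbf{B}\in\mathcal{K}$, a homomorphism $h:\mathbf{A}\to\mathbf{B}$ is a $\mathcal{K}$-epimorphism if for every $\mathbf{C}\in\mathcal{K}$ and homomorphisms $g,g':\mathbf{B}\to\mathbf{C}$, $gh=g'h$ implies $g=g'$. $\mathcal{K}$ has surjective epimorphisms if every $\mathcal{K}$-epimorphism (between members of $\mathcal{K}$) is surjective. *)

(* Defs.v *)
From mathcomp Require Import all_boot generic_quotient.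
From mathcomp Require Import boolp classical_sets filter.
From Stdlib Require List.

Set Implicit Arguments.
Unset Strict Implicit.
Unset Printing Implicit Defensive.

Local Open Scope classical_set_scope.
Local Open Scope quotient_scope.

(* A class of algebras is a predicate on algebras; the class operators Subalg,
   Pu and prod_class are closed under isomorphic copies. *)

Record signature := Signature {
  symbol : Type;
  arity : symbol -> nat }.

Record algebra (L : signature) := Algebra {
  carrier :> Type;
  op : forall f : symbol L, ('I_(arity f) -> carrier) -> carrier;
  carrier_nonempty : inhabited carrier }.

Arguments op {L} a f _.

Record hom (L : signature) (A B : algebra L) := Hom {
  hom_fun :> A -> B;
  hom_op : forall f (v : 'I_(arity f) -> A),
    hom_fun (op A f v) = op B f (hom_fun \o v) }.

Definition isomorphic (L : signature) (A B : algebra L) :=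
  exists h : hom A B, bijective h.

Record subalgebra (L : signature) (B : algebra L) := Subalgebra {
  subuniverse : set B;
  subuniverse_nonempty : subuniverse !=set0;
  subuniverse_op : forall f (v : 'I_(arity f) -> B),
    (forall i, subuniverse (v i)) -> subuniverse (op B f v) }.

Section SubalgebraAlgebra.
Variables (L : signature) (B : algebra L) (A : subalgebra B).

Definition sub_op (f : symbol L) (v : 'I_(arity f) -> {b : B | subuniverse A b}) :
    {b : B | subuniverse A b} :=
  exist _ (op B f (fun i => sval (v i)))
    (subuniverse_op (fun i => svalP (v i))).

Lemma sub_nonempty : inhabited {b : B | subuniverse A b}.
Proof. by have [b Ab] := subuniverse_nonempty A; exists; exists b. Qed.

Definition sub_algebra : algebra L := Algebra sub_op sub_nonempty.
End SubalgebraAlgebra.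

Coercion sub_algebra : subalgebra >-> algebra.

Section Products.
Variable L : signature.

Lemma prod_nonempty (C D : algebra L) : inhabited (C * D).
Proof. by case: (carrier_nonempty C) (carrier_nonempty D) => c [d]. Qed.

Definition prod_algebra (C D : algebra L) : algebra L :=
  Algebra (fun f (v : 'I_(arity f) -> C * D) =>
    (op C f (fst \o v), op D f (snd \o v))) (prod_nonempty C D).

Lemma bigprod_nonempty (I : Type) (F : I -> algebra L) :
  inhabited (forall i, F i).
Proof.
have h i : exists x : F i, True by case: (carrier_nonempty (F i)) => x; exists x.
by exists => i; exact: sval (cid (h i)).
Qed.

Definition bigprod_algebra (I : Type) (F : I -> algebra L) : algebra L :=
  Algebra (fun f (v : 'I_(arity f) -> forall i, F i) =>
    fun i => op (F i) f (fun k => v k i)) (bigprod_nonempty F).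
End Products.

Record congruence (L : signature) (A : algebra L) := Congruence {
  cong :> A -> A -> Prop;
  cong_refl : forall x, cong x x;
  cong_sym : forall x y, cong x y -> cong y x;
  cong_trans : forall x y z, cong x y -> cong y z -> cong x z;
  cong_op : forall f (v w : 'I_(arity f) -> A),
    (forall i, cong (v i) (w i)) -> cong (op A f v) (op A f w) }.

Section Quotients.
Variables (L : signature) (A : algebra L) (theta : congruence A).

Definition congb : rel {classic A} := fun x y => `[< theta x y >].

Lemma congb_refl : reflexive congb.
Proof. by move=> x; apply/asboolP; exact: cong_refl. Qed.

Lemma congb_sym : symmetric congb.
Proof. by move=> x y; apply/asboolP/asboolP; exact: cong_sym. Qed.

Lemma congb_trans : transitive congb.
Proof. by move=> y x z /asboolP xy /asboolP yz; apply/asboolP/(cong_trans xy). Qed.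

Canonical congb_equiv := EquivRel congb congb_refl congb_sym congb_trans.

Lemma quot_nonempty : inhabited {eq_quot congb_equiv}.
Proof.
by have [x] := carrier_nonempty A; exists; exact: (\pi_({eq_quot congb_equiv}) x).
Qed.

(* By cong_op, the operations do not depend on the representatives. *)
Definition quot_algebra : algebra L :=
  Algebra (carrier := {eq_quot congb_equiv})
    (fun f v => \pi_({eq_quot congb_equiv}) (op A f (fun i => repr (v i))))
    quot_nonempty.
End Quotients.

Lemma diag_op (L : signature) (A : algebra L) f (v w : 'I_(arity f) -> A) :
  (forall i, v i = w i) -> op A f v = op A f w.
Proof. by move=> /funext ->. Qed.

Definition diag_congruence (L : signature) (A : algebra L) : congruence A :=
  Congruence (@erefl A) (@esym A) (@etrans A) (@diag_op L A).

Section Ultraproducts.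
Variables (L : signature) (I : Type) (F : I -> algebra L).
Variables (U : set_system I) (UU : UltraFilter U).
Implicit Types x y z : bigprod_algebra F.

Definition ultra_eq x y := U [set i | x i = y i].

Lemma ultra_eq_refl x : ultra_eq x x.
Proof. exact: filterE. Qed.

Lemma ultra_eq_sym x y : ultra_eq x y -> ultra_eq y x.
Proof. by apply: filterS => i /= ->. Qed.

Lemma ultra_eq_trans x y z : ultra_eq x y -> ultra_eq y z -> ultra_eq x z.
Proof. by apply: filterS2 => i /= -> ->. Qed.

Lemma ultra_eq_op f (v w : 'I_(arity f) -> bigprod_algebra F) :
  (forall k, ultra_eq (v k) (w k)) ->
  ultra_eq (op (bigprod_algebra F) f v) (op (bigprod_algebra F) f w).
Proof.
have UF : Filter U by exact: _.
move=> vw; have := @filter_forall _ _ (fun k i => v k i = w k i) U UF vw.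
by apply: filterS => i /= e; congr (op _ _ _); exact/funext.
Qed.

Definition ultra_congruence : congruence (bigprod_algebra F) :=
  Congruence ultra_eq_refl ultra_eq_sym ultra_eq_trans ultra_eq_op.

Definition ultraproduct : algebra L := quot_algebra ultra_congruence.
End Ultraproducts.

Inductive term (L : signature) (X : Type) :=
  | Var of X
  | App (f : symbol L) of ('I_(arity f) -> term L X).

Fixpoint eval (L : signature) (X : Type) (A : algebra L) (v : X -> A)
    (t : term L X) : A :=
  match t with
  | Var x => v x
  | App f ts => op A f (fun i => eval v (ts i))
  end.

Definition equation (L : signature) : Type := term L nat * term L nat.

Definition holds (L : signature) (A : algebra L) (v : nat -> A)
  (e : equation L) := eval v e.1 = eval v e.2.

Record quasi_identity (L : signature) := QuasiIdentity {
  premises : seq (equation L);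
  conclusion : equation L }.

Definition satisfies (L : signature) (A : algebra L) (q : quasi_identity L) :=
  forall v : nat -> A,
    (forall e, List.In e (premises q) -> holds v e) -> holds v (conclusion q).

Definition quasivariety (L : signature) (Q : algebra L -> Prop) :=
  exists Phi : set (quasi_identity L),
    forall A, Q A <-> forall q, Phi q -> satisfies A q.

Definition majority_term (L : signature) (K : algebra L -> Prop)
    (t : term L 'I_3) :=
  forall A, K A -> forall x y : A,
    [/\ eval (tnth [tuple x; x; y]) t = x,
        eval (tnth [tuple x; y; x]) t = x
      & eval (tnth [tuple y; x; x]) t = x].

Section CompletelyMeetIrreducible.
Variables (T : Type) (le : T -> T -> Prop) (P : set T).

Definition is_meet (X : set T) (m : T) :=
  [/\ P m, forall x, X x -> le m x
    & forall z, P z -> (forall x, X x -> le z x) -> le z m].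

(* X may be empty, so the top element is not completely meet irreducible. *)
Definition completely_meet_irreducible (a : T) :=
  P a /\ forall X : set T, X `<=` P -> is_meet X a -> X a.
End CompletelyMeetIrreducible.

Section Classes.
Variables (L : signature).
Implicit Types (K Q : algebra L -> Prop).

Definition relative_congruences Q (A : algebra L) : set (congruence A) :=
  [set theta | Q (quot_algebra theta)].

Arguments relative_congruences Q A : clear implicits.

Definition cong_le (A : algebra L) (theta eta : congruence A) :=
  forall x y, theta x y -> eta x y.

Definition RSI Q (A : algebra L) :=
  Q A /\ completely_meet_irreducible (@cong_le A) (relative_congruences Q A)
           (diag_congruence A).

Definition Subalg K (A : algebra L) :=
  exists (B : algebra L) (S : subalgebra B), K B /\ isomorphic A S.

Definition Pu K (A : algebra L) :=
  exists (I : Type) (F : I -> algebra L) (U : set_system I)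
    (UU : UltraFilter U),
    (forall i, K (F i)) /\ isomorphic A (ultraproduct F UU).

Definition prod_class K K' (A : algebra L) :=
  exists C D : algebra L, [/\ K C, K' D & isomorphic A (prod_algebra C D)].

(* A itself and B need not belong to K. *)
Definition epic_subalgebra K (B : algebra L) (A : subalgebra B) :=
  forall C, K C -> forall g g' : hom B C,
    (forall a, subuniverse A a -> g a = g' a) -> g =1 g'.

Definition epimorphism K (A B : algebra L) (h : hom A B) :=
  forall C, K C -> forall g g' : hom B C, g \o h =1 g' \o h -> g =1 g'.

Definition surjective_epimorphisms K :=
  forall A B, K A -> K B -> forall h : hom A B,
    epimorphism K h -> forall b, exists a, h a = b.
End Classes.

(* Main.v *)
(* The substantial implication is (4) => (1). Let h : A -> B be an epimorphism
   of Q and b in B. Compactness: some finite s in A meets, for any two relative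
   congruences theta, eta of B with relatively subdirectly irreducible quotients,
   the set of a with h a congruent to b modulo both theta and eta. Otherwise
   every finite s yields a bad pair, and an ultraproduct over all s maps B to a
   member of S x S so that the image of b avoids the image of A, although the
   latter is epic in the image of B. Now each theta only matters through the
   finite set of members of s whose image is congruent to b modulo theta, so the
   Baker-Pixley argument with the majority term gives one a in A with h a
   congruent to b modulo every theta, and these theta meet to the equality. *)

Require Import Defs.
From mathcomp Require Import all_boot generic_quotient.
From mathcomp Require Import boolp classical_sets filter.
From Stdlib Require List.

Set Implicit Arguments.
Unset Strict Implicit.
Unset Printing Implicit Defensive.

Local Open Scope classical_set_scope.
Local Open Scope quotient_scope.

(** * Homomorphisms, products, images and embeddings *)

Section Homomorphisms.
Variable L : signature.
Implicit Types A B C : algebra L.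

Lemma eval_hom X A B (h : hom A B) (v : X -> A) (t : term L X) :
  h (eval v t) = eval (h \o v) t.
Proof.
elim: t => //= f ts IH; rewrite hom_op; congr (op _ _ _).
by apply: funext => i; exact: IH.
Qed.

Lemma hom_holds A B (h : hom A B) (v : nat -> A) (e : equation L) :
  holds v e -> holds (h \o v) e.
Proof. by rewrite /holds -!eval_hom => ->. Qed.

Lemma id_hom_op A f (v : 'I_(arity f) -> A) : id (op A f v) = op A f (id \o v).
Proof. by []. Qed.

Definition id_hom A : hom A A := Hom (@id_hom_op A).

Lemma comp_hom_op A B C (g : hom B C) (h : hom A B) f (v : 'I_(arity f) -> A) :
  (g \o h) (op A f v) = op C f ((g \o h) \o v).
Proof. by rewrite /= !hom_op. Qed.

Definition comp_hom A B C (g : hom B C) (h : hom A B) : hom A C :=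
  Hom (comp_hom_op g h).

Lemma pair_hom_op A B C (g : hom A B) (h : hom A C) f (v : 'I_(arity f) -> A) :
  (g (op A f v), h (op A f v)) =
  op (prod_algebra B C) f ((fun a => (g a, h a)) \o v).
Proof. by rewrite !hom_op. Qed.

Definition pair_hom A B C (g : hom A B) (h : hom A C) :
    hom A (prod_algebra B C) :=
  Hom (B := prod_algebra B C) (pair_hom_op g h).

Lemma fst_hom_op B C f (v : 'I_(arity f) -> prod_algebra B C) :
  (op (prod_algebra B C) f v).1 = op B f (fst \o v).
Proof. by []. Qed.

Definition fst_hom B C : hom (prod_algebra B C) B := Hom (@fst_hom_op B C).

Lemma snd_hom_op B C f (v : 'I_(arity f) -> prod_algebra B C) :
  (op (prod_algebra B C) f v).2 = op C f (snd \o v).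
Proof. by []. Qed.

Definition snd_hom B C : hom (prod_algebra B C) C := Hom (@snd_hom_op B C).

Section BigProduct.
Variables (I : Type) (F : I -> algebra L).

Lemma coord_hom_op i f (v : 'I_(arity f) -> bigprod_algebra F) :
  op (bigprod_algebra F) f v i = op (F i) f ((fun x => x i) \o v).
Proof. by []. Qed.

Definition coord_hom i : hom (bigprod_algebra F) (F i) := Hom (coord_hom_op i).

Lemma tuple_hom_op B (h : forall i, hom B (F i)) f (v : 'I_(arity f) -> B) :
  (fun i => h i (op B f v)) =
  op (bigprod_algebra F) f ((fun b i => h i b) \o v).
Proof. by apply: functional_extensionality_dep => i; rewrite hom_op. Qed.

Definition tuple_hom B (h : forall i, hom B (F i)) :
    hom B (bigprod_algebra F) :=
  Hom (B := bigprod_algebra F) (tuple_hom_op h).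

End BigProduct.

Lemma incl_hom_op B (A : subalgebra B) f (v : 'I_(arity f) -> A) :
  sval (op A f v) = op B f (sval \o v).
Proof. by []. Qed.

Definition incl_hom B (A : subalgebra B) : hom A B := Hom (@incl_hom_op B A).

Lemma incl_inj B (A : subalgebra B) : injective (incl_hom A).
Proof. by case=> a Aa [b Ab] ab; exact: eq_exist. Qed.

Section Image.
Variables (A B : algebra L) (h : hom A B).

Lemma image_nonempty : range h !=set0.
Proof. by have [a] := carrier_nonempty A; exists (h a), a. Qed.

Lemma image_op f (v : 'I_(arity f) -> B) :
  (forall i, range h (v i)) -> range h (op B f v).
Proof.
move=> hv; have w i : {a | h a = v i}.
  by apply: cid; have [a _ <-] := hv i; exists a.
exists (op A f (fun i => sval (w i))) => //; rewrite hom_op; congr (op _ _ _).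
by apply: funext => i /=; exact: svalP (w i).
Qed.

Definition image : subalgebra B := Subalgebra image_nonempty image_op.

Lemma to_image_op f (v : 'I_(arity f) -> A) :
  exist (range h) (h (op A f v)) (imageT h _) =
  op image f ((fun a => exist (range h) (h a) (imageT h a)) \o v).
Proof. by apply: eq_exist; rewrite hom_op. Qed.

Definition to_image : hom A image := Hom (B := image) to_image_op.

Lemma to_image_surj (b : image) : exists a, to_image a = b.
Proof. by case: b => b hb; have [a _ hab] := hb; exists a; exact: eq_exist. Qed.

End Image.

Lemma inj_surj_bij (X Y : Type) (f : X -> Y) :
  injective f -> (forall y, exists x, f x = y) -> bijective f.
Proof.
move=> f_inj f_surj; exists (fun y => sval (cid (f_surj y))).
  by move=> x; apply: f_inj; exact: svalP (cid (f_surj (f x))).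
by move=> y; exact: svalP (cid (f_surj y)).
Qed.

Lemma isomorphic_refl A : isomorphic A A.
Proof. by exists (id_hom A); exists id. Qed.

(** An embedding carries the same data as an isomorphism onto its image; in this form composing
    embeddings replaces all handling of nested subalgebras. *)
Lemma SubalgP K A :
  Subalg K A <-> exists B (h : hom A B), K B /\ injective h.
Proof.
split=> [[B [S [KB [h hbij]]]]|[B [h [KB h_inj]]]].
  exists B, (comp_hom (incl_hom S) h); split=> //.
  exact: inj_comp (@incl_inj _ S) (bij_inj hbij).
exists B, (image h); split=> //; exists (to_image h).
apply: inj_surj_bij; last exact: to_image_surj.
by move=> x y /(congr1 sval) /h_inj.
Qed.

Lemma Subalg_sub K A : K A -> Subalg K A.
Proof. by move=> KA; apply/SubalgP; exists A, (id_hom A); split=> // x y. Qed.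

Lemma Subalg_inj K A B (h : hom A B) : injective h -> Subalg K B -> Subalg K A.
Proof.
move=> h_inj /SubalgP[C [g [KC g_inj]]]; apply/SubalgP.
by exists C, (comp_hom g h); split=> //; exact: inj_comp.
Qed.

End Homomorphisms.

(** * Quotient maps and quasi-identities in quotients *)

Section QuotientMaps.
Variables (L : signature) (A : algebra L).
Implicit Types theta eta : congruence A.

Definition quot_map theta (x : A) : quot_algebra theta :=
  \pi_({eq_quot (congb_equiv theta)}) x.

Lemma quot_mapP theta x y :
  quot_map theta x = quot_map theta y <-> theta x y.
Proof.
split=> [/(eqmodP (congb_equiv theta) x y) /asboolP //|xy].
by apply/(eqmodP (congb_equiv theta) x y)/asboolP.
Qed.

Lemma quot_map_repr theta (z : quot_algebra theta) :
  quot_map theta (repr z) = z.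
Proof. exact: reprK. Qed.

Lemma quot_map_op theta f (v : 'I_(arity f) -> A) :
  quot_map theta (op A f v) = op (quot_algebra theta) f (quot_map theta \o v).
Proof.
apply/quot_mapP; apply: cong_op => i; apply/quot_mapP.
by rewrite quot_map_repr.
Qed.

Definition quot_hom theta : hom A (quot_algebra theta) :=
  Hom (@quot_map_op theta).

Lemma quot_homP theta x y :
  quot_hom theta x = quot_hom theta y <-> theta x y.
Proof. exact: quot_mapP. Qed.

Lemma quot_hom_repr theta (z : quot_algebra theta) :
  quot_hom theta (repr z) = z.
Proof. exact: quot_map_repr. Qed.

(** Every valuation in the quotient lifts along representatives, so the test can be carried out in
    [A] with [theta] in place of equality. *)
Lemma quot_satisfies theta q :
  satisfies (quot_algebra theta) q <->
  forall v : nat -> A,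
    (forall e, List.In e (premises q) -> theta (eval v e.1) (eval v e.2)) ->
    theta (eval v (conclusion q).1) (eval v (conclusion q).2).
Proof.
split=> sat v prem.
  apply/quot_homP; rewrite !(eval_hom (quot_hom theta)).
  apply: sat => e /prem ev; rewrite /holds -!(eval_hom (quot_hom theta)).
  exact/quot_homP.
have lift t : eval v t = quot_hom theta (eval (fun n => repr (v n)) t).
  rewrite eval_hom; congr (eval _ _); apply: funext => n.
  by rewrite /comp quot_hom_repr.
rewrite /holds !lift; apply/quot_homP/sat => e /prem.
by rewrite /holds !lift => /quot_homP.
Qed.

End QuotientMaps.

(** Closure under finite intersections, indexed by a list; it handles the premises of a
    quasi-identity in an ultraproduct. *)
Lemma filter_In (I T : Type) (U : set_system I) (FU : Filter U)
    (P : T -> set I) (s : seq T) :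
  (forall x, List.In x s -> U (P x)) ->
  U [set i | forall x, List.In x s -> P x i].
Proof.
elim: s => [|a s IH] Us; first by apply: filterE => i x [].
have Ua : U (P a) by apply: Us; left.
have {}Us : U [set i | forall x, List.In x s -> P x i].
  by apply: IH => x xs; apply: Us; right.
by apply: filterS2 Ua Us => i Pa Ps x [<-|/Ps].
Qed.

(** * Kernels and meets of congruences *)

Section Congruences.
Variable L : signature.
Implicit Types A B : algebra L.

Section Kernel.
Variables (A B : algebra L) (h : hom A B).

Lemma ker_op f (v w : 'I_(arity f) -> A) :
  (forall i, h (v i) = h (w i)) -> h (op A f v) = h (op A f w).
Proof. by move=> vw; rewrite !hom_op; congr (op _ _ _); exact: funext. Qed.

Definition ker : congruence A :=
  @Congruence L A (fun x y => h x = h y) (fun=> erefl) (fun _ _ => @esym _ _ _)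
    (fun _ _ _ => @etrans _ _ _ _) ker_op.

End Kernel.

Section Meet.
Variables (A : algebra L) (X : set (congruence A)).

Definition meet_rel (x y : A) := forall eta, X eta -> cong eta x y.

Lemma meet_refl x : meet_rel x x.
Proof. by move=> eta _; exact: cong_refl. Qed.

Lemma meet_sym x y : meet_rel x y -> meet_rel y x.
Proof. by move=> xy eta Xeta; apply/cong_sym/xy. Qed.

Lemma meet_trans x y z : meet_rel x y -> meet_rel y z -> meet_rel x z.
Proof. by move=> xy yz eta Xeta; exact: cong_trans (xy _ Xeta) (yz _ Xeta). Qed.

Lemma meet_op f (v w : 'I_(arity f) -> A) :
  (forall i, meet_rel (v i) (w i)) -> meet_rel (op A f v) (op A f w).
Proof. by move=> vw eta Xeta; apply: cong_op => i; exact: vw. Qed.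

Definition meet_congruence : congruence A :=
  Congruence meet_refl meet_sym meet_trans meet_op.

End Meet.

(** The remaining fields are proofs, hence irrelevant. Complete meet irreducibility asks for
    membership of the diagonal itself, so equality of the records is required. *)
Lemma cong_le_anti A (theta eta : congruence A) :
  cong_le theta eta -> cong_le eta theta -> theta = eta.
Proof.
move=> le ge; have : cong theta = cong eta.
  by apply: funext => x; apply: funext => y; apply: propext; split=> [/le|/ge].
case: theta eta {le ge} => r r1 r2 r3 r4 [r' r1' r2' r3' r4'] /= e; subst r'.
by congr Congruence; exact: Prop_irrelevance.
Qed.

End Congruences.

(** * Closure properties of a quasivariety *)

Section Quasivariety.
Variables (L : signature) (Q : algebra L -> Prop).
Hypothesis qvQ : quasivariety Q.
Implicit Types A B C : algebra L.

(** Homomorphisms preserve the premises of a quasi-identity, so its conclusion holds in every image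
    in [Q], and separation pulls it back to [A]. Closure under subalgebras and products are both
    instances. *)
Lemma separated_mem A :
  (forall x y : A, (forall B (h : hom A B), Q B -> h x = h y) -> x = y) -> Q A.
Proof.
have [Phi QP] := qvQ; move=> sep; apply/QP => q Phiq v prem.
apply: sep => B h QB; rewrite !eval_hom.
apply: ((QP B).1 QB q Phiq) => e /prem; exact: hom_holds.
Qed.

Lemma inj_mem A B (h : hom A B) : injective h -> Q B -> Q A.
Proof. by move=> h_inj QB; apply: separated_mem => x y /(_ _ h QB) /h_inj. Qed.

Lemma prod_mem A B : Q A -> Q B -> Q (prod_algebra A B).
Proof.
move=> QA QB; apply: separated_mem => -[x1 x2] [y1 y2] sep.
by congr (_, _); [exact: sep (fst_hom A B) QA | exact: sep (snd_hom A B) QB].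
Qed.

(** The case of the theorem of Łoś for quasi-identities: the finitely many premises hold together on
    a set of [U], and there the conclusion holds too. *)
Lemma ultraproduct_mem (I : Type) (F : I -> algebra L) (U : set_system I)
    (UU : UltraFilter U) :
  (forall i, Q (F i)) -> Q (ultraproduct F UU).
Proof.
have [Phi QP] := qvQ; move=> QF; apply/QP => q Phiq; apply/quot_satisfies => v.
have FU : Filter U by exact: _.
have evalE t i : eval v t i = eval (fun n => v n i) t.
  exact: (eval_hom (coord_hom F i)).
move=> /(@filter_In _ _ _ FU (fun e i => eval v e.1 i = eval v e.2 i)).
apply: filterS => i /= prem; rewrite !evalE.
apply: ((QP _).1 (QF i) q Phiq) => e /prem.
by rewrite /holds !evalE.
Qed.

Lemma Pu_mem K A : (forall B, K B -> Q B) -> Pu K A -> Q A.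
Proof.
move=> KQ [I [F [U [UU [KF [h hbij]]]]]]; apply: inj_mem (bij_inj hbij) _.
by apply: ultraproduct_mem => i; exact: KQ.
Qed.

Lemma Subalg_prod_mem K A :
  (forall B, K B -> Q B) -> Subalg (prod_class K K) A -> Q A.
Proof.
move=> KQ /SubalgP[B [h [[C [D [KC KD [g gbij]]]] h_inj]]].
apply: inj_mem h_inj _; apply: inj_mem (bij_inj gbij) _.
by apply: prod_mem; exact: KQ.
Qed.

(** The argument of [separated_mem] relative to [theta], using only homomorphisms that factor
    through the quotient. *)
Lemma quot_mem A (theta : congruence A) :
  (forall x y,
     (forall B (h : hom A B), Q B ->
        (forall z w, theta z w -> h z = h w) -> h x = h y) -> theta x y) ->
  Q (quot_algebra theta).
Proof.
have [Phi QP] := qvQ; move=> sep; apply/QP => q Phiq.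
apply/quot_satisfies => v prem; apply: sep => B h QB h_theta; rewrite !eval_hom.
apply: ((QP B).1 QB q Phiq) => e /prem /h_theta.
by rewrite /holds !eval_hom.
Qed.

Lemma chain_In A (C : set (congruence A)) (T : Type) (u v : T -> A) (s : seq T) :
  C !=set0 -> total_on C (@cong_le L A) ->
  (forall p, List.In p s -> exists2 eta, C eta & eta (u p) (v p)) ->
  exists2 eta, C eta & forall p, List.In p s -> eta (u p) (v p).
Proof.
move=> [eta0 C0] totC; elim: s => [|p s IH] Cs; first by exists eta0 => // p [].
have [eta1 C1 eta1p] := Cs p (or_introl erefl).
have [eta2 C2 eta2s] := IH (fun p' sp' => Cs p' (or_intror sp')).
have [le12|le21] := totC _ _ C1 C2.
  by exists eta2 => // p' [<-|/eta2s//]; exact: le12.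
by exists eta1 => // p' [<-//|/eta2s]; exact: le21.
Qed.

Lemma List_In_mem (T : eqType) (x : T) (s : seq T) : x \in s -> List.In x s.
Proof.
elim: s => //= y s IH; rewrite inE => /orP[/eqP->|/IH]; first by left.
by right.
Qed.

(** Operations have finite arity and quasi-identities have finitely many premises, so each instance
    already lives in a single member of the chain. *)
Lemma chain_union A (C : set (congruence A)) :
  C !=set0 -> total_on C (@cong_le L A) ->
  C `<=` @relative_congruences L Q A ->
  exists2 theta : congruence A, Q (quot_algebra theta) &
    forall x y, theta x y <-> exists2 eta, C eta & eta x y.
Proof.
move=> C0 totC QC.
pose un (x y : A) := exists2 eta, C eta & cong eta x y.
have un_refl x : un x x.
  by have [eta Ceta] := C0; exists eta => //; exact: cong_refl.
have un_sym x y : un x y -> un y x.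
  by move=> [eta Ceta xy]; exists eta => //; exact: cong_sym.
have un_trans x y z : un x y -> un y z -> un x z.
  move=> [eta Ceta xy] [eta' Ceta' yz].
  have [le|le] := totC _ _ Ceta Ceta'.
    by exists eta' => //; exact: cong_trans (le _ _ xy) yz.
  by exists eta => //; exact: cong_trans xy (le _ _ yz).
have un_op f (v w : 'I_(arity f) -> A) :
    (forall i, un (v i) (w i)) -> un (op A f v) (op A f w).
  move=> vw; have [|eta Ceta etavw] :=
      @chain_In A C _ v w (enum 'I_(arity f)) C0 totC.
    by move=> i _; exact: vw.
  exists eta => //; apply: cong_op => i; apply/etavw/List_In_mem.
  by rewrite mem_enum.
exists (Congruence un_refl un_sym un_trans un_op) => //.
have [Phi QP] := qvQ; apply/QP => q Phiq; apply/quot_satisfies => v.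
move=> /(chain_In C0 totC)[eta Ceta prem]; exists eta => //.
by have /QP/(_ q Phiq)/quot_satisfies := QC _ Ceta; exact.
Qed.

(** * Separation of points by relatively subdirectly irreducible quotients *)

(** Zorn's lemma on the relative congruences omitting the pair [(x, y)], with unions as upper bounds
    of nonempty chains. *)
Lemma maximal_separating A (x y : A) : Q A -> x <> y ->
  exists theta : congruence A,
    [/\ Q (quot_algebra theta), ~ theta x y &
      forall eta : congruence A, Q (quot_algebra eta) -> cong_le theta eta ->
        ~ cong_le eta theta -> eta x y].
Proof.
move=> QA xy.
pose T := {theta : congruence A | Q (quot_algebra theta) /\ ~ theta x y}.
pose R : rel T := fun s t => `[< cong_le (sval s) (sval t) >].
have T0 : T.
  exists (diag_congruence A); split=> //.
  by apply: quot_mem => z w /(_ A (id_hom A) QA); exact.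
have [||C totC|[theta [Qtheta thetaxy]] max] := @ZL_preorder T T0 R.
- by move=> t; apply/asboolP => z w.
- move=> r s t /asboolP rs /asboolP st; apply/asboolP => z w /rs; exact: st.
(* The empty chain has no union in this sense; the diagonal bounds it. *)
- have [C0|C0] := pselect (C !=set0); last first.
    by exists T0 => s Cs; case: C0; exists s.
  have [|||theta Qtheta thetaP] := @chain_union A (sval @` C).
  + by have [t Ct] := C0; exists (sval t), t.
  + move=> _ _ [s Cs <-] [t Ct <-].
    by have [/asboolP|/asboolP] := totC _ _ Cs Ct; [left|right].
  + by move=> _ [s Cs <-]; case: (svalP s).
  have thetaxy : ~ theta x y.
    by move=> /thetaP[_ [s Cs <-]]; case: (svalP s).
  exists (exist _ theta (conj Qtheta thetaxy)) => s Cs.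
  by apply/asboolP => z w szw; apply/thetaP; exists (sval s) => //; exists s.
exists theta; split=> // eta Qeta le nle; apply: contrapT => etaxy.
apply: nle; apply/asboolP.
apply: (max (exist _ eta (conj Qeta etaxy))); exact/asboolP.
Qed.

(** The relative form of Birkhoff's subdirect representation: a relative congruence maximal among
    those omitting [(x, y)] has a relatively subdirectly irreducible quotient. *)
Lemma RSI_separating A (x y : A) : Q A -> x <> y ->
  exists2 theta : congruence A, RSI Q (quot_algebra theta) & ~ theta x y.
Proof.
move=> QA /(maximal_separating QA)[theta [Qtheta thetaxy max]].
exists theta => //; split=> //; split.
  by apply: quot_mem => z w /(_ _ (id_hom _) Qtheta); exact.
move=> X XQ [_ _ glb]; apply: contrapT => Xdiag.
set D := quot_algebra theta in X XQ glb Xdiag *.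
pose pi := quot_hom theta.
(* A member of [X] is not the diagonal, so its pullback to [A] lies strictly above [theta] and by
   maximality contains [(x, y)]. *)
have Xxy eta : X eta -> eta (pi x) (pi y).
  move=> Xeta; pose h := comp_hom (quot_hom eta) pi.
  have hP z w : h z = h w <-> eta (pi z) (pi w) by exact: quot_homP.
  apply/hP; apply: (max (ker h)).
  - by apply: quot_mem => z w /(_ _ h (XQ _ Xeta)); exact.
  - by move=> z w /quot_homP zw; apply/hP; rewrite /pi zw; exact: cong_refl.
  - move=> le; apply: Xdiag; suff <- : eta = diag_congruence D by [].
    apply: cong_le_anti => [p q|p q /= ->]; last exact: cong_refl.
    rewrite -(quot_hom_repr p) -(quot_hom_repr q) => /hP /le zw.
    exact/quot_homP.
(* The meet of [X] is again a relative congruence and relates [pi x] to [pi y]; lying below the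
   diagonal, it forces them to be equal. *)
apply: thetaxy; apply/quot_homP; apply: (glb (meet_congruence X)) => //.
  apply: quot_mem => z w sep eta Xeta; apply/quot_homP.
  by apply: sep (quot_hom eta) (XQ _ Xeta) _ => a b ab; apply/quot_homP/ab.
by move=> eta Xeta z w zw; exact: zw.
Qed.

End Quasivariety.

(** * An ultrafilter on finite lists and the Baker-Pixley argument *)

Lemma In_ultrafilter (T : Type) :
  exists2 U : set_system (seq T), UltraFilter U &
    forall a, U [set s | List.In a s].
Proof.
(* The sets that contain all lists extending some fixed list form a proper filter: concatenation
   bounds two lists. *)
pose F : set_system (seq T) :=
  [set P | exists s, forall s', List.incl s s' -> P s'].
have FF : ProperFilter F.
  split; first by move=> [s /(_ s (List.incl_refl s))].
  split; first by exists [::].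
  - move=> P P' [s sP] [s' sP']; exists (s ++ s') => s'' ss; split.
      by apply: sP => x xs; apply: ss; apply/List.in_or_app; left.
    by apply: sP' => x xs; apply: ss; apply/List.in_or_app; right.
  - by move=> P P' PP' [s sP]; exists s => s' /sP /PP'.
have [U [UU FU]] := ultraFilterLemma FF; exists U => // a; apply: FU.
by exists [:: a] => s; apply; left.
Qed.

(** A Helly property: sets closed under [m] as soon as two of its arguments lie in them have a
    common point for any finite family, given that they meet pairwise. *)
Lemma majority_helly (T W : Type) (m : T -> T -> T -> T) (P : W -> set T)
    (t0 : T) (s : seq W) :
  (forall w a b c, P w a -> P w b ->
     [/\ P w (m a b c), P w (m a c b) & P w (m c a b)]) ->
  (forall w w', P w `&` P w' !=set0) ->
  exists a, forall w, List.In w s -> P w a.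
Proof.
move=> maj pair; have [n] := ubnP (size s).
elim: n s => // n IH [|w1 [|w2 [|w3 s]]] /= sn; first by exists t0.
- by have [a [Pa _]] := pair w1 w1; exists a => w [<-|].
- by have [a [P1 P2]] := pair w1 w2; exists a => w [<-//|[<-|]].
have [a1 P1] := IH (w2 :: w3 :: s) sn.
have [a2 P2] := IH (w1 :: w3 :: s) sn.
have [a3 P3] := IH (w1 :: w2 :: s) sn.
(* Each [ai] may fail only the condition [wi], so every condition holds for at least two of the
   three arguments. *)
exists (m a1 a2 a3) => w.
case=> [<-|[<-|[<-|sw]]].
- by have [] := maj w1 a2 a3 a1; [apply: P2; left | apply: P3; left |].
- by have [] := maj w2 a1 a3 a2; [apply: P1; left | apply: P3; right; left |].
- by have [] := maj w3 a1 a2 a3;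
    [apply: P1; right; left | apply: P2; right; left |].
by have [] := maj w a1 a2 a3;
  [apply: P1; right; right | apply: P2; right; right |].
Qed.

(** * Transfer of epimorphisms between [Q] and [SS] *)

Section SurjectiveEpimorphisms.
Variables (L : signature) (Q : algebra L -> Prop).
Hypothesis qvQ : quasivariety Q.
Implicit Types A B C : algebra L.

Let S := Pu (RSI Q).
Let SS := prod_class S S.

Lemma RSI_mem A : RSI Q A -> Q A.
Proof. by case. Qed.

Lemma Subalg_SS_mem A : Subalg SS A -> Q A.
Proof.
by apply: (Subalg_prod_mem qvQ) => B; apply: (Pu_mem qvQ); exact: RSI_mem.
Qed.

Lemma ultraproduct_S (I : Type) (F : I -> algebra L) (U : set_system I)
    (UU : UltraFilter U) :
  (forall i, RSI Q (F i)) -> S (ultraproduct F UU).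
Proof. by exists I, F, U, UU; split=> //; exact: isomorphic_refl. Qed.

Lemma RSI_embed A : RSI Q A -> exists2 B, SS B & exists h : hom A B, injective h.
Proof.
move=> RA.
(* The ultrapower over a one-point index set is a copy of [A], which then embeds diagonally in its
   square. *)
have UU : UltraFilter (principal_filter tt) by exact: principal_filter_ultra.
pose C := ultraproduct (fun=> A) UU.
pose h : hom A C := comp_hom (quot_hom _) (tuple_hom (fun=> id_hom A)).
have SC : S C by exact: ultraproduct_S.
exists (prod_algebra C C); first by exists C, C; split=> //; exact: isomorphic_refl.
exists (pair_hom h h) => x y /(congr1 fst) /quot_homP /principal_filterP.
exact.
Qed.

(** Two homomorphisms that differ at a point still differ after passing to a relatively subdirectly
    irreducible quotient of the target, and that quotient embeds in a member of [SS]. *)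
Lemma epic_subalgebra_SS B (A : subalgebra B) :
  epic_subalgebra SS A -> epic_subalgebra Q A.
Proof.
move=> epiA C QC g g' gA b; apply: contrapT => gb.
have [theta RSItheta] := RSI_separating qvQ QC gb; apply.
have [D SSD [h h_inj]] := RSI_embed RSItheta.
pose k := comp_hom h (quot_hom theta).
apply/quot_homP/h_inj.
by apply: (epiA D SSD (comp_hom k g) (comp_hom k g')) => a /gA /= ->.
Qed.

Lemma epimorphism_finite_cover A B (h : hom A B) (b : B) :
  surjective_epimorphisms (Subalg SS) -> epimorphism Q h ->
  exists s : seq A, forall theta eta : congruence B,
    RSI Q (quot_algebra theta) -> RSI Q (quot_algebra eta) ->
    exists2 a, List.In a s & theta (h a) b /\ eta (h a) b.
Proof.
move=> surj epi; apply: contrapT => /forallNP nos.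
have bad s : {p : congruence B * congruence B |
    [/\ RSI Q (quot_algebra p.1), RSI Q (quot_algebra p.2) &
      forall a, List.In a s -> ~ (p.1 (h a) b /\ p.2 (h a) b)]}.
  apply: cid; have /existsNP[theta /existsNP[eta]] := nos s.
  move=> /not_implyP[Rtheta /not_implyP[Reta nos']]; exists (theta, eta).
  by split=> // a sa ab; apply: nos'; exists a.
have [U UU Uin] := In_ultrafilter A.
pose F s := quot_algebra (sval (bad s)).1.
pose G s := quot_algebra (sval (bad s)).2.
have SF : S (ultraproduct F UU).
  by apply: ultraproduct_S => s; case: (svalP (bad s)).
have SG : S (ultraproduct G UU).
  by apply: ultraproduct_S => s; case: (svalP (bad s)).
pose f := pair_hom
  (comp_hom (quot_hom (ultra_congruence F UU)) (tuple_hom (fun s => quot_hom _)))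
  (comp_hom (quot_hom (ultra_congruence G UU)) (tuple_hom (fun s => quot_hom _)))
  : hom B (prod_algebra (ultraproduct F UU) (ultraproduct G UU)).
have SSB : Subalg SS (image f).
  apply: Subalg_inj (@incl_inj _ _ _) _; apply: Subalg_sub.
  by do 2!eexists; split; [exact: SF | exact: SG | exact: isomorphic_refl].
pose fA := image (comp_hom (to_image f) h).
have SSA : Subalg SS fA by exact: Subalg_inj (@incl_inj _ _ _) SSB.
(* [B] maps onto [image f], so homomorphisms out of [image f] can be compared on [B], where [epi]
   applies because the targets lie in [Q]. *)
have epi_incl : epimorphism (Subalg SS) (incl_hom fA).
  move=> C SSC g g' gg' b'; have [c <-] := to_image_surj b'.
  apply: (epi C (Subalg_SS_mem SSC) (comp_hom g (to_image f))
                (comp_hom g' (to_image f))) => a.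
  exact: (gg' (to_image (comp_hom (to_image f) h) a)).
have [[z zA] zb] := surj _ _ SSA SSB _ epi_incl (to_image f b).
have [a _ az] := zA; have ab : f (h a) = f b := congr1 sval (etrans az zb).
have /quot_homP Ua := congr1 fst ab.
have /quot_homP Ub := congr1 snd ab.
(* Three sets of [U] share an index [s]: [h a] and [b] agree in both quotients of its bad pair, and
   yet [a] belongs to [s]. *)
have [s [[/= sa sb] sin]] := filter_ex (filterI (filterI Ua Ub) (Uin a)).
have [_ _ /(_ a sin)] := svalP (bad s); apply; split.
  by apply/quot_homP.
by apply/quot_homP.
Qed.

Lemma comp_tuple3 (X Y : Type) (g : X -> Y) a b c :
  g \o tnth [tuple a; b; c] = tnth [tuple g a; g b; g c].
Proof.
apply: funext => -[[|[|[|//]]] lt3];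
  by rewrite /comp !(tnth_nth (g a)) !(tnth_nth a).
Qed.

Lemma surjective_epimorphisms_of_Subalg :
  (exists t, majority_term Q t) ->
  surjective_epimorphisms (Subalg SS) -> surjective_epimorphisms Q.
Proof.
move=> [t majt] surj A B QA QB h epi b.
have [s cover] := epimorphism_finite_cover b surj epi.
have [a0] := carrier_nonempty A.
(* The predicates P w are finitely many conditions on a, one for each possible
   trace w of a congruence class of b on s. *)
pose type (theta : congruence B) : {set 'I_(size s)} :=
  finset (fun k : 'I_(size s) => `[< theta (h (nth a0 s k)) b >]).
pose P (w : {set 'I_(size s)}) (a : A) := forall theta : congruence B,
  RSI Q (quot_algebra theta) -> type theta = w -> theta (h a) b.
pose m (x y z : A) := eval (tnth [tuple x; y; z]) t.
have maj w x y z : P w x -> P w y ->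
    [/\ P w (m x y z), P w (m x z y) & P w (m z x y)].
  (* Modulo [theta] two arguments of the majority term become the class of [b], so its value is that
     class. *)
  move=> Px Py; split=> theta Rtheta tw; apply/quot_homP;
    have /quot_homP xb := Px _ Rtheta tw; have /quot_homP yb := Py _ Rtheta tw;
    rewrite !eval_hom !comp_tuple3 xb yb;
    by have [] := majt _ (RSI_mem Rtheta) (quot_hom theta b)
      (quot_hom theta (h z)).
have [|a aP] := @majority_helly A _ m P a0 (enum {set 'I_(size s)}) maj.
  move=> w w'.
  (* A trace realised by no congruence imposes no condition, so only realised traces need the finite
     cover. *)
  have real v : (exists theta : congruence B,
      RSI Q (quot_algebra theta) /\ type theta = v) \/ forall a, P v a.
    have [|no] := pselect (exists theta : congruence B,
      RSI Q (quot_algebra theta) /\ type theta = v); first by left.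
    by right=> a theta Rtheta tv; case: no; exists theta.
  have common (theta eta : congruence B) : RSI Q (quot_algebra theta) ->
      RSI Q (quot_algebra eta) -> P (type theta) `&` P (type eta) !=set0.
    move=> Rtheta Reta; have [a sa [theta_ab eta_ab]] := cover _ _ Rtheta Reta.
    have [k ka] : exists k : 'I_(size s), nth a0 s k = a.
      elim: (s) sa => //= c s' IH [->|/IH[k kE]]; first by exists ord0.
      by exists (lift ord0 k).
    (* A congruence [zeta] with the same trace treats the [k]-th entry [a] of [s] alike, so it too
       relates [h a] to [b]. *)
    by exists a; split=> zeta _ /setP/(_ k);
      rewrite !finset.in_set ka => e; apply/asboolP; rewrite e; exact/asboolP.
  have [[theta [Rtheta <-]]|Pw] := real w; have [[eta [Reta <-]]|Pw'] := real w'.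
  - exact: common.
  - by have [a [Pa _]] := common _ _ Rtheta Rtheta; exists a.
  - by have [a [Pa _]] := common _ _ Reta Reta; exists a.
  - by exists a0.
exists a; apply: contrapT => /(RSI_separating qvQ QB)[theta Rtheta]; apply.
by apply: (aP (type theta)) => //; apply: List_In_mem; rewrite mem_enum.
Qed.

End SurjectiveEpimorphisms.

(** * The cycle of implications *)

Theorem theorem10 (L : signature) (Q : algebra L -> Prop)
    (quasivariety_Q : quasivariety Q)
    (majority_Q : exists t, majority_term Q t) :
  let S := Pu (RSI Q) in
  let SS := prod_class S S in
  [<-> surjective_epimorphisms Q;
       forall (B : algebra L) (A : subalgebra B), Q A -> Q B ->
         epic_subalgebra Q A -> subuniverse A = setT;
       forall (B : algebra L) (A : subalgebra B), Subalg SS A -> Subalg SS B ->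
         epic_subalgebra SS A -> subuniverse A = setT;
       surjective_epimorphisms (Subalg SS)].
Proof.
move=> S SS; tfae.
- move=> surj B A QA QB epiA; apply/seteqP; split=> // b _.
  have epi : epimorphism Q (incl_hom A).
    by move=> C QC g g' gg'; apply: epiA => // a Aa; exact: (gg' (exist _ a Aa)).
  by have [[a Aa] <-] := surj _ _ QA QB _ epi b.
- move=> closed B A /(Subalg_SS_mem quasivariety_Q) QA
    /(Subalg_SS_mem quasivariety_Q) QB.
  by move=> /(epic_subalgebra_SS quasivariety_Q); exact: closed.
- move=> closed A B SSA SSB h epi b.
  have SSim : Subalg SS (image h) := Subalg_inj (@incl_inj _ _ _) SSB.
  (* Members of [SS] are admissible targets for [epi], and agreement on the image is agreement after
     composing with [h]. *)
  have epi_im : epic_subalgebra SS (image h).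
    move=> C SSC g g' gg'; apply: epi (Subalg_sub SSC) _ _ _ => a.
    by apply: gg'; exists a.
  have [a _ ab] : subuniverse (image h) b
    by rewrite (closed _ _ SSim SSB epi_im).
  by exists a.
- exact: surjective_epimorphisms_of_Subalg.
Qed.
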